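(* Let $K \subseteq \mathbb{R}^n$ be a proper cone and let $\{X_i\}_{i=1}^\infty$ be a sequence in $\mathbb{R}^{n \times n}$. Suppose that $0 \preceq_K X_i \preceq_K X_{i+1}$ for all positive integers $i$, and that there exist $s, r \in \mathbb{R}^n$ with $r \succ_K 0$ such that $X_i r \preceq_K s$ for all positive integers $i$. Then $\{X_i\}_{i=1}^\infty$ converges.
   Context: A set $K \subseteq \mathbb{R}^n$ is a cone if $x \in K$ and $\alpha \geq 0$ imply $\alpha x \in K$. A cone is proper if it is convex, closed, pointed ($K \cap -K = \{0\}$) and has non-empty interior. For vectors $x, y \in \mathbb{R}^n$, $x \succeq_K y$ (equivalently $y \preceq_K x$) means $x - y \in K$, and $x \succ_K y$ means that $x - y$ lies in the interior of $K$. For matrices $X, Y \in \mathbb{R}^{n\times n}$, $X \succeq_K Y$ (equivalently $Y \preceq_K X$) means that $X - Y$ is $K$-nonnegative, i.e. $(X-Y)K \subseteq K$. Convergence is in $\mathbb{R}^{n\times n}$ with its usual topology (any norm; equivalently entrywise). *)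

(* Defs.v *)
From mathcomp Require Import all_boot all_order all_algebra.
From mathcomp Require Import all_classical all_reals all_analysis.

Set Implicit Arguments.
Unset Strict Implicit.
Unset Printing Implicit Defensive.

Import Order.TTheory GRing.Theory Num.Theory.
Import numFieldNormedType.Exports.

Local Open Scope classical_set_scope.
Local Open Scope ring_scope.

Definition cone (R : realType) (n : nat) (K : set 'cV[R]_n) : Prop :=
  forall (x : 'cV[R]_n) (a : R), K x -> 0 <= a -> K (a *: x).

Definition pointed (R : realType) (n : nat) (K : set 'cV[R]_n) : Prop :=
  K `&` [set - x | x in K] = [set 0].

Record proper_cone (R : realType) (n : nat) (K : set 'cV[R]_n) : Prop :=
  ProperCone {
    proper_cone_cone : cone K;
    proper_cone_convex : convex_set K;
    proper_cone_closed : closed K;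
    proper_cone_pointed : pointed K;
    proper_cone_interior : K° !=set0
  }.

(* [vge K x y], [vgt K x y] and [mge K X Y] have the larger side first: they are
   x >=_K y, x >_K y and X >=_K Y. The matrix order is induced by the
   K-nonnegative matrices, not by a cone of entries. *)
Definition vge (R : realType) (n : nat) (K : set 'cV[R]_n) (x y : 'cV[R]_n)
  : Prop := K (x - y).

Definition vgt (R : realType) (n : nat) (K : set 'cV[R]_n) (x y : 'cV[R]_n)
  : Prop := K° (x - y).

Definition K_nonnegative (R : realType) (n : nat) (K : set 'cV[R]_n)
  (A : 'M[R]_n) : Prop := [set A *m x | x in K] `<=` K.

Definition mge (R : realType) (n : nat) (K : set 'cV[R]_n) (X Y : 'M[R]_n)
  : Prop := K_nonnegative K (X - Y).

(* Main.v *)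
Require Import Defs.
From mathcomp Require Import all_boot all_order all_algebra.
From mathcomp Require Import all_classical all_reals all_analysis.
From mathcomp Require Import ring.

Set Implicit Arguments.
Unset Strict Implicit.
Unset Printing Implicit Defensive.

Import Order.TTheory GRing.Theory Num.Theory.
Import numFieldNormedType.Exports.

Local Open Scope classical_set_scope.
Local Open Scope ring_scope.

(** The K-nonnegative matrices form a closed convex cone P in the space of
    n x n matrices, and the sequence is increasing for the order of P, so the
    argument is the one for bounded monotone sequences of reals, with
    compactness in the role of the supremum; it never looks at the vectors
    X_i x separately.

    The key fact ([K_nonnegative_eq0]) is that a matrix A of P with A r = 0, r
    interior to K, is zero: for any x and small t > 0 both r + t x and r - t x
    lie in K, so A maps them to t A x and - t A x, which lie in K, and K is
    pointed. It has two consequences.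
    - P is pointed, so its order is antisymmetric ([mge_anti]).
    - The set of all A in P with A r <=_K s is bounded ([K_nonnegative_bounded]).
      This is where the hypothesis on s and r enters: it bounds the sequence in
      norm, although no matrix is given that bounds it in the order.

    By compactness the sequence has a cluster point L. As P is closed, every
    cluster point is above all X_i, hence above every other cluster point; by
    antisymmetry L is the only one, and a sequence in a compact set with a single
    cluster point converges to it. *)

Lemma cvg_mx_coord (R : realType) (m n : nat) (T : Type) (F : set_system T)
    {FF : Filter F} (f : T -> 'M[R]_(m, n)) (L : 'M[R]_(m, n)) :
  (forall i j, f t i j @[t --> F] --> L i j) -> f @ F --> L.
Proof.
move=> fL U [V VL VU]; apply: (filterS (fun t => VU (f t))).
by do 2!apply: filter_forall => ?; apply: fL.
Qed.

Lemma mulmxr_continuous (R : realType) (m n p : nat) (B : 'M[R]_(n, p)) :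
  continuous (fun A : 'M[R]_(m, n) => A *m B).
Proof.
move=> A; apply: (@cvg_mx_coord _ _ _ _ (nbhs A)) => i k; rewrite mxE.
under eq_fun do rewrite mxE.
apply: cvg_big => [|j _]; first exact: add_continuous.
apply: cvgMr_tmp; exact: coord_continuous.
Qed.

Lemma vec_mx_continuous (R : realType) (m n : nat) :
  continuous (@vec_mx R m n).
Proof.
move=> v; apply: (@cvg_mx_coord _ _ _ _ (nbhs v)) => i j; rewrite mxE.
under eq_fun do rewrite mxE.
exact: coord_continuous.
Qed.

Lemma mx_coord_le_norm (R : realType) (m n : nat) (A : 'M[R]_(m, n)) i j :
  `|A i j| <= `|A|.
Proof.
rewrite [leRHS]/Num.norm/= mx_normrE.
exact: (le_bigmax _ (fun ij : 'I_m * 'I_n => `|A ij.1 ij.2|) (i, j)).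
Qed.

Lemma mx_norm_ball_closed (R : realType) (m n : nat) (B : R) :
  closed [set A : 'M[R]_(m, n) | `|A| <= B].
Proof.
apply: (@preimage_closed _ _ (fun A : 'M[R]_(m, n) => `|A|) [set x | x <= B]).
  by move=> A _; exact: norm_continuous.
exact: closed_le.
Qed.

(** Heine-Borel for matrices, transported from row vectors along [vec_mx]. *)
Lemma mx_norm_ball_compact (R : realType) (m n : nat) (B : R) :
  compact [set A : 'M[R]_(m, n) | `|A| <= B].
Proof.
pose box := [set v : 'rV[R]_(m * n) | forall k, `[- B, B]%classic (v ord0 k)].
have box_compact : compact (vec_mx @` box : set 'M[R]_(m, n)).
  apply: continuous_compact.
    by apply: continuous_subspaceT => v; exact: vec_mx_continuous.
  apply: (@rV_compact _ _ (fun=> `[- B, B]%classic)) => _.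
  exact: segment_compact.
apply: (subclosed_compact _ box_compact); first exact: mx_norm_ball_closed.
move=> A /= AB; exists (mxvec A); last by rewrite mxvecK.
move=> k; case/mxvec_indexP: k => i j /=; rewrite mxvecE in_itv/= -ler_norml.
exact: le_trans (mx_coord_le_norm A i j) AB.
Qed.

Lemma pointed_eq0 (R : realType) (n : nat) (K : set 'cV[R]_n) (x : 'cV[R]_n) :
  pointed K -> K x -> K (- x) -> x = 0.
Proof.
move=> Kp Kx KNx; have : (K `&` [set - y | y in K]) x.
  by split=> //; exists (- x); rewrite ?opprK.
by rewrite Kp.
Qed.

(** Twice the midpoint of x and y. *)
Lemma proper_coneD (R : realType) (n : nat) (K : set 'cV[R]_n)
    (x y : 'cV[R]_n) : proper_cone K -> K x -> K y -> K (x + y).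
Proof.
move=> hK Kx Ky.
have half_ge0 : 0 <= 2^-1 :> R by rewrite invr_ge0.
have half_le1 : 2^-1 <= 1 :> R by rewrite invf_le1// ler1n.
have /set_mem Kmid := @proper_cone_convex _ _ _ hK x y
  (Itv01 half_ge0 half_le1) (mem_set Kx) (mem_set Ky).
have := proper_cone_cone hK Kmid (ler0n R 2).
rewrite /conv/= scalerDr !scalerA.
rewrite (_ : 2 * unstable.onem 2^-1 = 1 :> R); last first.
  by rewrite /unstable.onem; field.
by rewrite divff ?pnatr_eq0// !scale1r.
Qed.

Lemma K_nonnegative_closed (R : realType) (n : nat) (K : set 'cV[R]_n) :
  closed K -> closed (K_nonnegative K).
Proof.
move=> Kc.
rewrite (_ : K_nonnegative K =
    \bigcap_(x in K) [set A : 'M[R]_n | K (A *m x)]); last first.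
  apply/seteqP; split=> A AK; first by move=> x Kx; apply: AK; exists x.
  by move=> _ [x Kx <-]; exact: AK.
apply: closed_bigI => x _.
apply: (@preimage_closed _ _ (fun A : 'M[R]_n => A *m x)) => //.
by move=> A _; exact: mulmxr_continuous.
Qed.

(** An interior point r of K detects every K-nonnegative matrix: any direction x
    can be reached from r in both senses without leaving K, so A r = 0 forces
    both A x and - A x into K. *)
Lemma K_nonnegative_eq0 (R : realType) (n : nat) (K : set 'cV[R]_n)
    (r : 'cV[R]_n) (A : 'M[R]_n) :
  pointed K -> K° r -> K_nonnegative K A -> A *m r = 0 -> A = 0.
Proof.
move=> Kp Kr AK Ar0.
suff Ax0 (x : 'cV[R]_n) : A *m x = 0.
  apply/matrixP => i j; have /colP/(_ i) := Ax0 (delta_mx j 0).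
  by rewrite -colE !mxE.
have lim_r (y : 'cV[R]_n) : (r + t *: y) @[t --> (0 : R)] --> r.
  rewrite -[X in _ --> X]addr0 -(scale0r y).
  by apply: cvgD; [exact: cvg_cst|apply: cvgZr_tmp; exact: cvg_id].
have Kt (y : 'cV[R]_n) : \forall t \near 0^'+, K (A *m (t *: y)).
  have Kry : \forall t \near 0^'+, K (r + t *: y).
    by apply: (cvg_at_right_filter (lim_r y)); exact: Kr.
  apply: filterS Kry => t Kry.
  rewrite -[A *m _]add0r -Ar0 -mulmxDr; apply: AK.
  by exists (r + t *: y).
near (0 : R)^'+ => t.
have t0 : t != 0 by apply: lt0r_neq0; near: t; exact: nbhs_right_gt.
have : A *m (t *: x) = 0.
  apply: (pointed_eq0 Kp); first by near: t.
  by rewrite -mulmxN -scalerN; near: t.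
by rewrite -scalemxAr => /eqP; rewrite scaler_eq0 (negbTE t0) => /eqP.
Unshelve. all: by end_near. Qed.

(** By homogeneity this reduces to matrices A of norm 1: it suffices that
    A r <=_K w fails for all of them once w is close to 0. At w = 0 it fails
    because A r and - A r in K would give A r = 0, hence A = 0; since K is closed
    it still fails near (A, 0), and the compactness of the unit sphere of
    K-nonnegative matrices makes the neighbourhood of 0 uniform in A. *)
Lemma K_nonnegative_bounded (R : realType) (n : nat) (K : set 'cV[R]_n)
    (r s : 'cV[R]_n) : proper_cone K -> K° r ->
  exists B : R, forall A : 'M[R]_n,
    K_nonnegative K A -> K (s - A *m r) -> `|A| <= B.
Proof.
move=> hK Kr.
pose S := [set A : 'M[R]_n | K_nonnegative K A /\ `|A| = 1].
have S_compact : compact S.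
  apply: (subclosed_compact _ (@mx_norm_ball_compact R n n 1)); last first.
    by move=> A [_ /= ->].
  apply: closedI; first exact: K_nonnegative_closed (proper_cone_closed hK).
  apply: (@preimage_closed _ _ (fun A : 'M[R]_n => `|A|) [set x | x = 1]).
    by move=> A _; exact: norm_continuous.
  exact: closed_eq.
have /nbhs_ballP[d /= d0 Hd] : \forall w \near (0 : 'cV[R]_n),
    S `<=` [set A | ~ K (w - A *m r)].
  have /compact_near_coveringP S_cover := S_compact.
  apply: (S_cover _ (nbhs (0 : 'cV[R]_n))
    (fun w A => ~ K (w - A *m r))) => A [AK A1].
  have NKAr : ~ K (0 - A *m r).
    rewrite sub0r => KNAr.
    have A0 : A = 0.
      apply: (K_nonnegative_eq0 (proper_cone_pointed hK) Kr AK).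
      apply: (pointed_eq0 (proper_cone_pointed hK) _ KNAr).
      by apply: AK; exists r => //; exact: interior_subset.
    by move: A1; rewrite A0 normr0 => /eqP; rewrite eq_sym oner_eq0.
  have lim_sub : (p.2 - p.1 *m r) @[p --> (A, (0 : 'cV[R]_n))] --> 0 - A *m r.
    apply: cvgB; first exact: cvg_snd.
    apply: (@cvg_comp _ _ _ fst (fun B : 'M[R]_n => B *m r) _ (nbhs A)).
      exact: cvg_fst.
    exact: mulmxr_continuous.
  have : nbhs (0 - A *m r) (~` K).
    apply: open_nbhs_nbhs; split=> //.
    exact: closed_openC (proper_cone_closed hK).
  by move/lim_sub.
(* If `|A| > `|s| / d, then s / `|A| is within d of 0, and A / `|A| violates Hd. *)
exists (`|s| / d) => A AK As.
rewrite leNgt; apply/negP => ltA.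
have A0 : 0 < `|A| by apply: le_lt_trans ltA; rewrite divr_ge0// ltW.
apply: (Hd (`|A|^-1 *: s) _ (`|A|^-1 *: A)).
- rewrite /= -ball_normE /ball_/= sub0r normrN normrZ normfV normr_id.
  by rewrite ltr_pdivrMl// -ltr_pdivrMr.
- split; last by rewrite normrZ normfV normr_id mulVf// gt_eqF.
  move=> _ [x Kx <-]; rewrite -scalemxAl.
  apply: (proper_cone_cone hK); last by rewrite invr_ge0.
  by apply: AK; exists x.
- rewrite -scalemxAl -scalerBr.
  by apply: (proper_cone_cone hK) => //; rewrite invr_ge0.
Qed.

Lemma mge_trans (R : realType) (n : nat) (K : set 'cV[R]_n)
    (A B C : 'M[R]_n) :
  proper_cone K -> mge K A B -> mge K B C -> mge K A C.
Proof.
move=> hK AB BC _ [x Kx <-].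
rewrite (_ : A - C = (A - B) + (B - C)); last by rewrite addrA subrK.
rewrite mulmxDl.
by apply: proper_coneD => //; [apply: AB|apply: BC]; exists x.
Qed.

Lemma mge_anti (R : realType) (n : nat) (K : set 'cV[R]_n) (A B : 'M[R]_n) :
  proper_cone K -> mge K A B -> mge K B A -> A = B.
Proof.
move=> hK AB BA; have [r Kr] := proper_cone_interior hK.
have Kr' := interior_subset Kr.
apply/eqP; rewrite -subr_eq0; apply/eqP.
apply: (K_nonnegative_eq0 (proper_cone_pointed hK) Kr AB).
apply: (pointed_eq0 (proper_cone_pointed hK)); first by apply: AB; exists r.
by rewrite -mulNmx opprB; apply: BA; exists r.
Qed.

Lemma mge_closed_lower (R : realType) (n : nat) (K : set 'cV[R]_n)
    (A : 'M[R]_n) : closed K -> closed [set B | mge K B A].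
Proof.
move=> Kc; apply: (@preimage_closed _ _ (fun B : 'M[R]_n => B - A)).
  by move=> B _; apply: (@cvgB _ _ _ (nbhs B)); [exact: cvg_id|exact: cvg_cst].
exact: K_nonnegative_closed.
Qed.

Lemma mge_closed_upper (R : realType) (n : nat) (K : set 'cV[R]_n)
    (A : 'M[R]_n) : closed K -> closed [set B | mge K A B].
Proof.
move=> Kc; apply: (@preimage_closed _ _ (fun B : 'M[R]_n => A - B)).
  by move=> B _; apply: (@cvgB _ _ _ (nbhs B)); [exact: cvg_cst|exact: cvg_id].
exact: K_nonnegative_closed.
Qed.

Lemma cluster_closed (T : topologicalType) (F : set_system T) (C : set T) :
  closed C -> F C -> cluster F `<=` C.
Proof. by move=> cC FC x; rewrite clusterE => /(_ _ FC) /cC. Qed.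

Theorem theorem2 (R : realType) (n : nat) (K : set 'cV[R]_n)
    (X : nat -> 'M[R]_n)
    (hK : proper_cone K)
    (hX : forall i : nat, (0 < i)%N -> mge K (X i) 0 /\ mge K (X i.+1) (X i))
    (hb : exists s r : 'cV[R]_n,
        vgt K r 0 /\ (forall i : nat, (0 < i)%N -> vge K s (X i *m r))) :
  cvgn X.
Proof.
have [s [r [Kr Xs]]] := hb; rewrite /vgt subr0 in Kr.
have Kc := proper_cone_closed hK.
have [B HB] := K_nonnegative_bounded s hK Kr.
have XB i : (0 < i)%N -> `|X i| <= B.
  move=> i0; apply: HB; last exact: Xs.
  by have [+ _] := hX _ i0; rewrite /mge subr0.
have X_homo i j : (0 < i)%N -> (i <= j)%N -> mge K (X j) (X i).
  move=> i0; elim: j => [|j IH]; first by rewrite leqNgt i0.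
  rewrite leq_eqVlt => /predU1P[<-|].
    by move=> _ [x Kx <-]; rewrite subrr mul0mx -(scale0r x);
      exact: (proper_cone_cone hK).
  rewrite ltnS => ij; apply: (mge_trans hK) (IH ij).
  exact: (hX j (leq_trans i0 ij)).2.
(* The radius is B + 1 because the uniqueness criterion for limits in a compact
   set needs that set to be a neighbourhood of the limit, not only to contain
   the sequence. *)
have XV : (X @ \oo) [set A : 'M[R]_n | `|A| <= B + 1].
  by exists 1%N => // i /= i0; rewrite (le_trans (XB i i0))// lerDl.
have [L [_ cL]] := mx_norm_ball_compact _ XV.
have cluster_ge L' i : cluster (X @ \oo) L' -> (0 < i)%N -> mge K L' (X i).
  move=> cL' i0; apply: (cluster_closed (mge_closed_lower (A := X i) Kc)) cL'.
  by exists i => // j /=; exact: X_homo.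
have cluster_mge L1 L2 :
    cluster (X @ \oo) L1 -> cluster (X @ \oo) L2 -> mge K L1 L2.
  move=> c1; apply: (cluster_closed (mge_closed_upper (A := L1) Kc)).
  by exists 1%N => // i /=; exact: cluster_ge.
have LB : `|L| <= B.
  apply: (cluster_closed (@mx_norm_ball_closed R n n B)) cL.
  by exists 1%N => // i; exact: XB.
apply/cvg_ex; exists L.
apply: (compact_cluster_set1 _ (@mx_norm_ball_compact R n n (B + 1))) => //.
- have := @nbhsx_ballx _ _ L 1 ltr01; apply: filterS => A.
  rewrite -ball_normE /ball_/= => LA.
  rewrite (_ : A = L - (L - A)); last by rewrite subKr.
  by rewrite (le_trans (ler_normB _ _))// lerD// ltW.
- apply/seteqP; split=> [L' cL'|_ ->//].
  by apply: (mge_anti hK); exact: cluster_mge.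
Qed.
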